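(* Suppose $H$ is a graph with $m$ vertices and $e$ edges, and let $c$ be a constant such that $2\pi m(1-c)>1$ and $$c+(1-c)\log(1-c)\ \ge\ \frac{2}{m-1}+\frac{1}{12\binom{m}{2}^2}.$$ If $e\ge c\binom{m}{2}$, then $H$ is not $\binom{m}{2}$-anti-common.
   Context: $\log$ is the natural logarithm. All graphs are finite and simple. An $r$-edge-coloring of a graph is a function from its edge set to $\{1,\dots,r\}$ (not necessarily proper). A subgraph is rainbow if its edges have pairwise distinct colors. A copy of $H$ in $K_n$ is a (not necessarily induced) subgraph of $K_n$ isomorphic to $H$. Let $H$ be a graph with $m$ vertices and $e$ edges, and let $\mathrm{Aut}(H)$ be its set of automorphisms. $rb_r(H;n)$ denotes the maximum, over all $r$-edge-colorings of $K_n$, of the number of rainbow copies of $H$ in $K_n$. Put $rbC_r(H;n)=\dfrac{rb_r(H;n)}{\binom{n}{m}\frac{m!}{|\mathrm{Aut}(H)|}}$, and let $rbC_r(H)=\lim_{n\to\infty} rbC_r(H;n)$ (this limit exists). For $r\ge m$, $H$ is called $r$-anti-common if $rbC_r(H)=\dfrac{\binom{r}{e}e!}{r^e}$.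
   Formalization: The constant c is assumed nonnegative: for negative c the claim is false (m = 10, c = -5, H one edge plus 8 isolated vertices is 45-anti-common); also m > 1, so that 2/(m-1) and the binomial reciprocal are defined. *)

(* Defs.v *)
From HB Require Import structures.
From mathcomp Require Import all_boot all_order all_algebra perm.
From mathcomp Require Import all_classical all_reals all_analysis.
Import Order.TTheory GRing.Theory Num.Theory.
Import numFieldNormedType.Exports.

Set Implicit Arguments.
Unset Strict Implicit.
Unset Printing Implicit Defensive.

Local Open Scope ring_scope.

Record sgraph := SGraph {
  vertex :> finType;
  adj : rel vertex;
  adj_sym : symmetric adj;
  adj_irr : irreflexive adj
}.

Definition edges (G : sgraph) : {set {set G}} :=
  [set A : {set G} | [exists x : G, exists y : G, adj x y && (A == [set x; y])]].

Definition edge (G : sgraph) : finType := {A : {set G} | A \in edges G}.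

Definition edge_set (G : sgraph) (a : edge G) : {set G} := val a.

Definition graph_aut (G : sgraph) : {set {perm G}} :=
  [set s : {perm G} | [forall x : G, forall y : G, adj (s x) (s y) == adj x y]].

Lemma complete_sym n : symmetric (fun x y : 'I_n => x != y).
Proof. by move=> x y; rewrite eq_sym. Qed.

Lemma complete_irr n : irreflexive (fun x y : 'I_n => x != y).
Proof. by move=> x; rewrite eqxx. Qed.

Definition complete (n : nat) : sgraph :=
  SGraph (@complete_sym n) (@complete_irr n).

(* A subgraph of G is a pair (V, F) of a vertex set and an edge set such that
   both ends of every edge in F lie in V. The vertex set is part of the data:
   isolated vertices of H matter when copies of H are counted. *)
Definition is_subgraph (G : sgraph) (S : {set G} * {set edge G}) : bool :=
  [forall a in S.2, edge_set a \subset S.1].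

Definition isomorphic_to (G H : sgraph) (S : {set G} * {set edge G}) : bool :=
  [exists f : {ffun H -> G},
    [&& injectiveb f, f @: [set: H] == S.1 &
      [forall x : H, forall y : H,
        adj x y == ([set f x; f y] \in [set edge_set a | a in S.2])]]].

Definition copies (H G : sgraph) : {set {set G} * {set edge G}} :=
  [set S | is_subgraph S && isomorphic_to H S].

Definition edge_coloring (r : nat) (G : sgraph) : finType :=
  {ffun edge G -> 'I_r}.

Definition rainbow (r : nat) (G : sgraph) (col : {ffun edge G -> 'I_r})
    (S : {set G} * {set edge G}) : bool :=
  dinjectiveb col S.2.

Definition rb (r : nat) (H : sgraph) (n : nat) : nat :=
  \max_(col : edge_coloring r (complete n))
    #|[set S in copies H (complete n) | rainbow col S]|.

(* For n < #|H| the denominator is 0, so that the quotient is 0 by convention;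
   this does not affect the limit. *)
Definition rbC_seq (R : realType) (r : nat) (H : sgraph) (n : nat) : R :=
  (rb r H n)%:R / ('C(n, #|H|)%:R * ((#|H|)`!%:R / #|graph_aut H|%:R)).

Definition rbC (R : realType) (r : nat) (H : sgraph) : R :=
  limn (rbC_seq R r H).

(* Meaningful for #|H| <= r. *)
Definition anti_common (R : realType) (r : nat) (H : sgraph) : Prop :=
  rbC R r H = ('C(r, #|edges H|)%:R * (#|edges H|)`!%:R) / r%:R ^+ #|edges H|.

(* Main.v *)
Require Import Defs.
From HB Require Import structures.
From mathcomp Require Import all_boot all_order all_algebra perm.
From mathcomp Require Import all_classical all_reals all_analysis.
From mathcomp Require Import ring lra.
Import Order.TTheory GRing.Theory Num.Theory.
Import numFieldNormedType.Exports.

(** Write [N] for ['C(m, 2)] and [phi c] for [c + (1 - c) * ln (1 - c)]. A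
    uniformly random [N]-edge-coloring makes a copy of [H] rainbow with
    probability [N ^_ e / N ^ e], and [H] would be [N]-anti-common if this were
    the optimal density. A structured coloring does better as soon as [H] has
    enough edges: split the vertices of [K_n] into [m] equal parts and color an
    edge between two different parts by the pair of parts that it joins. Every
    copy of [H] with one vertex in each part is then rainbow, whatever [e] is,
    and these copies have density at least [m! / m ^ m] (lemma [rbC_ge]). What
    remains is the numerical inequality [N ^_ e / N ^ e < m! / m ^ m].

    For the density bound, copies are replaced by embeddings of [H]: every copy
    is the image of exactly [#|Aut H|] embeddings, so that the normalized count
    is the largest number of rainbow embeddings divided by [n ^_ m]. Averaging
    over the deletion of a vertex shows that this quotient is nonincreasing in
    [n]. Hence the limit exists, and it suffices to bound the quotient from
    below at the multiples of [m], where the parts can be chosen equal.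

    For the numerical inequality, [ln (N ^_ e / N ^ e)] is the sum of the
    concave function [ln (1 - x / N)] over the integers [0 <= x < e]. The
    trapezoidal rule underestimates the integral of a concave function, which
    gives [N ^_ e / N ^ e <= exp (- N * phi c) / sqrt (1 - c)] whenever
    [c * N <= e] ([ffact_ratio_le_expR]). If [phi c >= 2 / (m - 1)], then
    [N * phi c >= m], and the bound is at most [4 * exp (- m)] as long as
    [1 - c >= 1 / 16]. The inequality follows from the elementary estimate
    [4 * exp (- m) < m! / m ^ m], valid for [m > 3] ([fact_ratio_gt]). For [c]
    above [15 / 16] one may lower [c] to [15 / 16], since [phi (15 / 16)] is
    still at least [2 / 3 >= 2 / (m - 1)]; and [m > 3] holds because
    [phi c < 1]. *)

Set Implicit Arguments.
Unset Strict Implicit.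
Unset Printing Implicit Defensive.

(** * Embeddings and copies of a graph *)

Lemma edgesP (G : sgraph) (A : {set G}) :
  reflect (exists x y, adj x y /\ A = [set x; y]) (A \in edges G).
Proof.
rewrite inE; apply: (iffP existsP) => [[x /existsP[y /andP[xy /eqP ->]]]|].
  by exists x, y.
by move=> [x [y [xy ->]]]; exists x; apply/existsP; exists y; rewrite xy eqxx.
Qed.

Lemma set2_edges (G : sgraph) (x y : G) : ([set x; y] \in edges G) = adj x y.
Proof.
apply/edgesP/idP => [[u [v [uv E]]]|xy]; last by exists x, y.
have nuv : u != v by apply: contraTneq uv => ->; rewrite adj_irr.
have : (u \in [set x; y]) && (v \in [set x; y]) by rewrite E set21 set22.
rewrite !inE => /andP[/orP[]/eqP ux /orP[]/eqP vx]; move: uv nuv;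
  rewrite ux vx ?eqxx // adj_sym //.
Qed.

(** States the predicate of the subtype, which unification cannot recover from
    the proof alone. *)
Definition mk_edge (G : sgraph) (A : {set G}) (hA : A \in edges G) : edge G :=
  Sub A hA.

Lemma edge_setP (G : sgraph) (a : edge G) :
  exists x y, adj x y /\ edge_set a = [set x; y].
Proof. exact/edgesP/(valP a). Qed.

(** Preservation of adjacency is required in one direction only, because copies
    are subgraphs that need not be induced. *)
Definition is_emb (H G : sgraph) (f : {ffun H -> G}) : bool :=
  injectiveb f && [forall x, forall y, adj x y ==> adj (f x) (f y)].

Record emb (H G : sgraph) := Emb {emb_fun :> {ffun H -> G}; _ : is_emb emb_fun}.

HB.instance Definition _ H G := [isSub of emb H G for @emb_fun H G].
HB.instance Definition _ H G := [Finite of emb H G by <:].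

Lemma emb_inj (H G : sgraph) (f : emb H G) : injective f.
Proof. by case: f => f /= /andP[/injectiveP]. Qed.

Lemma emb_adj (H G : sgraph) (f : emb H G) x y : adj x y -> adj (f x) (f y).
Proof. by case: f => f /= /andP[_ /forallP/(_ x)/forallP/(_ y)/implyP]. Qed.

Lemma emb_edge (H G : sgraph) (f : emb H G) (a : edge H) :
  f @: edge_set a \in edges G.
Proof.
have [x [y [xy ->]]] := edge_setP a.
by rewrite imsetU !imset_set1 set2_edges emb_adj.
Qed.

Definition map_edge (H G : sgraph) (f : emb H G) (a : edge H) : edge G :=
  mk_edge (emb_edge f a).

Lemma map_edge_inj (H G : sgraph) (f : emb H G) : injective (map_edge f).
Proof.
by move=> a b /(congr1 val)/(imset_inj (@emb_inj _ _ f)) ab; apply: val_inj.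
Qed.

Lemma emb_comp_subproof (F H G : sgraph) (g : emb H G) (f : emb F H) :
  is_emb [ffun x => g (f x)].
Proof.
apply/andP; split.
  by apply/injectiveP => x y; rewrite !ffunE => /emb_inj/emb_inj.
by apply/forallP => x; apply/forallP => y; apply/implyP => xy;
   rewrite !ffunE !emb_adj.
Qed.

Definition emb_comp (F H G : sgraph) (g : emb H G) (f : emb F H) : emb F G :=
  Emb (emb_comp_subproof g f).

Lemma map_edge_comp (F H G : sgraph) (g : emb H G) (f : emb F H) (a : edge F) :
  map_edge (emb_comp g f) a = map_edge g (map_edge f a).
Proof.
apply: val_inj; rewrite /= -imset_comp.
by apply: eq_imset => x; rewrite /= ffunE.
Qed.

Lemma emb_comp_inj (F H G : sgraph) (g : emb H G) :
  injective (fun f : emb F H => emb_comp g f).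
Proof.
move=> f f' /(congr1 val)/ffunP E; apply/val_inj/ffunP => x.
by have := E x; rewrite /= !ffunE => /emb_inj.
Qed.

Definition copy_of (H G : sgraph) (f : emb H G) : {set G} * {set edge G} :=
  (f @: [set: H], [set map_edge f a | a : edge H]).

(** Non-edges of [H] matter here: the edge set of the copy is exactly the image of
    that of [H], so an embedding also reflects adjacency into its own copy. *)
Lemma mem_copy_of (H G : sgraph) (f : emb H G) x y :
  ([set f x; f y] \in [set edge_set a | a in (copy_of f).2]) = adj x y.
Proof.
apply/imsetP/idP => [[b /imsetP[a _ ->]]|xy].
  rewrite /= -!imset_set1 -imsetU => /(imset_inj (@emb_inj _ _ f)) E.
  by rewrite -set2_edges E (valP a).
have xyE : [set x; y] \in edges H by rewrite set2_edges.
pose a : edge H := mk_edge xyE.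
by exists (map_edge f a); rewrite ?imset_f// /edge_set /= imsetU !imset_set1.
Qed.

Lemma copies_imset (H G : sgraph) : copies H G = @copy_of H G @: [set: emb H G].
Proof.
apply/setP => -[V F]; rewrite inE; apply/idP/imsetP; last first.
  move=> [f _ ->]; apply/andP; split.
    apply/forallP => b; apply/implyP => /imsetP[a _ ->].
    by rewrite imsetS ?subsetT.
  apply/existsP; exists (val f); apply/and3P; split=> //.
    by apply/injectiveP; apply: emb_inj.
  by apply/forallP => x; apply/forallP => y; rewrite mem_copy_of.
move=> /andP[/forallP sub /existsP[f /and3P[injf /eqP fV /forallP fF]]].
have {}fF x y : adj x y = ([set f x; f y] \in [set edge_set a | a in F]).
  by have /forallP/(_ y)/eqP := fF x.
have embf : is_emb f.
  rewrite /is_emb injf; apply/forallP => x; apply/forallP => y; apply/implyP.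
  by rewrite fF => /imsetP[a _ E]; rewrite -set2_edges E (valP a).
exists (Emb embf) => //; congr (_, _); first by rewrite fV.
apply/setP => b; apply/idP/imsetP => [bF|[a _ ->]].
  have /implyP/(_ bF) := sub b; rewrite -fV /= => bV.
  have [u [v [uv bE]]] := edge_setP b.
  have /imsetP[x _ ux] : u \in f @: [set: H].
    by apply: (fintype.subsetP bV); rewrite bE set21.
  have /imsetP[y _ vy] : v \in f @: [set: H].
    by apply: (fintype.subsetP bV); rewrite bE set22.
  have xyE : [set x; y] \in edges H.
    by rewrite set2_edges fF -ux -vy -bE imset_f.
  exists (mk_edge xyE) => //; apply: val_inj.
  by rewrite [RHS]/= imsetU !imset_set1 -ux -vy -bE.
have [x [y [xy aE]]] := edge_setP a.
have := xy; rewrite fF => /imsetP[d dF E].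
suff -> : map_edge (Emb embf) a = d by [].
by apply: val_inj; rewrite /= aE imsetU !imset_set1 E.
Qed.

Lemma map_edge_surj (H : sgraph) (s : emb H H) (b : edge H) :
  exists a, b = map_edge s a.
Proof.
have [inv _ invK] := injF_bij (@map_edge_inj _ _ s).
by exists (inv b); rewrite invK.
Qed.

(** Finiteness makes a self-embedding an automorphism: it acts injectively, hence
    bijectively, on the finite edge set. *)
Lemma emb_self_adj (H : sgraph) (s : emb H H) (x y : H) :
  adj (s x) (s y) = adj x y.
Proof.
apply/idP/idP => [sxy|]; last exact: emb_adj.
have sE : [set s x; s y] \in edges H by rewrite set2_edges.
have [a aE] := map_edge_surj s (mk_edge sE).
rewrite -(mem_copy_of s); apply/imsetP; exists (mk_edge sE) => //.
by rewrite aE imset_f.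
Qed.

Lemma card_emb_self (H : sgraph) : #|{: emb H H}| = #|graph_aut H|.
Proof.
pose perm_of (s : emb H H) : {perm H} := perm (@emb_inj _ _ s).
have perm_of_inj : injective perm_of.
  move=> s t /permP E; apply/val_inj/ffunP => x.
  by have := E x; rewrite !permE.
rewrite -cardsT -(card_imset _ perm_of_inj); apply: eq_card => p.
apply/imsetP/idP => [[s _ ->]|].
  rewrite inE; apply/forallP => x; apply/forallP => y.
  by rewrite !permE emb_self_adj.
rewrite inE => /forallP pA.
have p_emb : is_emb [ffun x => p x].
  apply/andP; split.
    by apply/injectiveP => x y; rewrite !ffunE => /perm_inj.
  apply/forallP => x; apply/forallP => y; apply/implyP.
  by rewrite !ffunE; have /forallP/(_ y)/eqP-> := pA x.
by exists (Emb p_emb) => //; apply/permP => x; rewrite permE /= ffunE.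
Qed.

Lemma copy_of_comp_self (H G : sgraph) (f : emb H G) (s : emb H H) :
  copy_of (emb_comp f s) = copy_of f.
Proof.
have sT : s @: [set: H] = [set: H].
  apply/eqP; rewrite eqEcard finset.subsetT /= card_imset//; exact: emb_inj.
congr (_, _).
  have -> : f @: [set: H] = f @: (s @: [set: H]) by rewrite sT.
  by rewrite -imset_comp; apply: eq_imset => x; rewrite /= ffunE.
apply/setP => b; apply/imsetP/imsetP => -[a _ ->].
  by exists (map_edge s a); rewrite // map_edge_comp.
by have [a' ->] := map_edge_surj s a; exists a'; rewrite // map_edge_comp.
Qed.

(** Two embeddings with the same copy have the same vertex image, so one is the
    other composed with a permutation of [H]; having the same edges forces this
    permutation to preserve adjacency. *)
Lemma card_copy_of_fiber (H G : sgraph) (f : emb H G) :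
  #|[set g : emb H G | copy_of g == copy_of f]| = #|graph_aut H|.
Proof.
rewrite -card_emb_self -cardsT -(card_imset _ (@emb_comp_inj H _ _ f)).
apply: eq_card => g; rewrite inE; apply/eqP/imsetP => [E|[s _ ->]]; last first.
  exact: copy_of_comp_self.
have fg x : exists y, g x == f y.
  have : g x \in (copy_of f).1 by rewrite -E imset_f.
  by case/imsetP => y _ ->; exists y.
pose s x := xchoose (fg x).
have gE x : g x = f (s x) by apply/eqP/(xchooseP (fg x)).
have s_emb : is_emb [ffun x => s x].
  apply/andP; split.
    by apply/injectiveP => x y; rewrite !ffunE => sxy;
       apply: (@emb_inj _ _ g); rewrite !gE sxy.
  apply/forallP => x; apply/forallP => y; apply/implyP => xy.
  by rewrite !ffunE -(mem_copy_of f) -!gE -E mem_copy_of.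
by exists (Emb s_emb) => //; apply/val_inj/ffunP => x; rewrite /= !ffunE gE.
Qed.

Definition rainbow_embs (r : nat) (H G : sgraph) (col : edge_coloring r G) :
    {set emb H G} :=
  [set f | injectiveb (fun a : edge H => col (map_edge f a))].

Lemma rainbow_copy_of (r : nat) (H G : sgraph) (col : edge_coloring r G)
    (f : emb H G) :
  rainbow col (copy_of f) = (f \in rainbow_embs H col).
Proof.
rewrite inE; apply/dinjectiveP/injectiveP => [inj a b E|inj].
  by apply: (@map_edge_inj _ _ f); apply: inj; rewrite ?imset_f.
by move=> _ _ /imsetP[a _ ->] /imsetP[b _ ->] /inj ->.
Qed.

(** Being rainbow depends only on the copy, so the fibers of [copy_of] over rainbow
    copies all have [#|graph_aut H|] elements. *)
Lemma card_rainbow_embs (r : nat) (H G : sgraph) (col : edge_coloring r G) :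
  #|rainbow_embs H col|
  = (#|[set S in copies H G | rainbow col S]| * #|graph_aut H|)%N.
Proof.
rewrite -sum1_card.
rewrite (partition_big (@copy_of H G)
  [in [set S in copies H G | rainbow col S]]) /=; last first.
  by move=> f fR; rewrite inE copies_imset imset_f// rainbow_copy_of.
rewrite -sum_nat_const; apply: eq_bigr => S; rewrite inE copies_imset.
case/andP => /imsetP[f _ ->] fR; rewrite sum1_card -(card_copy_of_fiber f).
apply: eq_card => g; rewrite inE unfold_in.
case: (eqVneq (copy_of g) (copy_of f)) => [E|]; last by rewrite andbF.
by rewrite andbT -rainbow_copy_of E.
Qed.

(** * The rainbow density is nonincreasing *)

Lemma inj_is_emb (H : sgraph) (n : nat) (f : H -> 'I_n) : injective f ->
  is_emb (G := complete n) [ffun x => f x].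
Proof.
move=> f_inj; apply/andP; split.
  by apply/injectiveP => x y; rewrite !ffunE => /f_inj.
apply/forallP => x; apply/forallP => y; apply/implyP => xy.
rewrite /= !ffunE (inj_eq f_inj).
by apply: contraTneq xy => ->; rewrite adj_irr.
Qed.

Definition inj_emb (H : sgraph) (n : nat) (f : H -> 'I_n)
  (f_inj : injective f) : emb H (complete n) := Emb (inj_is_emb f_inj).

Definition lift_emb (n : nat) (v : 'I_n.+1) :
  emb (complete n) (complete n.+1) :=
  @inj_emb (complete n) _ (lift v) (@lift_inj _ v).

Definition max_rainbow (r : nat) (H : sgraph) (n : nat) : nat :=
  \max_(col : edge_coloring r (complete n)) #|rainbow_embs H col|.

Lemma max_rainbow_rb (r : nat) (H : sgraph) (n : nat) :
  max_rainbow r H n = (rb r H n * #|graph_aut H|)%N.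
Proof.
rewrite /max_rainbow (eq_bigr _ (fun col _ => card_rainbow_embs H col)).
by rewrite /rb (big_morph _ (fun x y => maxnMl x y #|graph_aut H|) (mul0n _)).
Qed.

(** An embedding that avoids [v] lives in the complete graph on the other vertices,
    where it is rainbow for the restricted coloring. *)
Lemma card_rainbow_avoid (r : nat) (H : sgraph) (n : nat) (v : 'I_n.+1)
    (col : edge_coloring r (complete n.+1)) :
  #|[set f in rainbow_embs H col | v \notin f @: [set: H]]|
    <= max_rainbow r H n.
Proof.
pose colv : edge_coloring r (complete n) :=
  [ffun b => col (map_edge (lift_emb v) b)].
apply: leq_trans (leq_bigmax colv).
rewrite -(card_imset _ (@emb_comp_inj H _ _ (lift_emb v))).
apply/subset_leq_card/fintype.subsetP => f; rewrite !inE => /andP[/injectiveP fR fv].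
have fl x : exists j, f x == lift v j.
  have [j fj|fj] := unliftP v (f x); first by exists j; apply/eqP.
  by case/negP: fv; rewrite -fj imset_f.
have g_inj : injective (fun x => xchoose (fl x)).
  move=> x y E; apply: (@emb_inj _ _ f).
  by rewrite (eqP (xchooseP (fl x))) E -(eqP (xchooseP (fl y))).
have fE : f = emb_comp (lift_emb v) (inj_emb g_inj).
  by apply/val_inj/ffunP => x; rewrite /= !ffunE; apply/eqP/(xchooseP (fl x)).
apply/imsetP; exists (inj_emb g_inj) => //; rewrite inE.
by apply/injectiveP => a b; rewrite !ffunE -!map_edge_comp -fE => /fR.
Qed.

(** Double counting of the pairs of a rainbow embedding in [K_(n+1)] and a vertex
    that it avoids: each embedding misses [n.+1 - #|H|] vertices. *)
Lemma max_rainbow_averaging (r : nat) (H : sgraph) (n : nat) :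
  (n.+1 - #|H|) * max_rainbow r H n.+1 <= n.+1 * max_rainbow r H n.
Proof.
rewrite {1}/max_rainbow.
elim/big_ind: _ => [|x y Hx Hy|col _]; first by rewrite muln0.
  by rewrite maxnMr geq_max Hx Hy.
have : \sum_(v : 'I_n.+1)
    #|[set f in rainbow_embs H col | v \notin f @: [set: H]]|
    <= n.+1 * max_rainbow r H n.
  rewrite mulnC -iter_addn_0 -big_const_ord.
  by apply: leq_sum => v _; exact: card_rainbow_avoid.
apply: leq_trans; rewrite mulnC -sum_nat_const.
under [leqRHS]eq_bigr => v _.
  rewrite -sum1_card.
  under eq_bigl => f do rewrite inE.
  rewrite big_mkcondr.
  over.
rewrite exchange_big /=; apply: leq_sum => f _.
rewrite -big_mkcond /= sum1_card -cardsT -(card_imset _ (@emb_inj _ _ f)).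
rewrite -[X in X - _]card_ord.
by rewrite -(cardsC (f @: [set: H])) addKn; apply/eq_leq/eq_card => v; rewrite inE.
Qed.

(** * The balanced blow-up of a rainbow complete graph *)

Lemma card_edge_complete (m : nat) : #|{: edge (complete m)}| = 'C(m, 2).
Proof.
rewrite card_sig -[m in RHS]card_ord -card_draws.
apply: eq_card => A; rewrite [RHS]inE; apply/edgesP/cards2P.
  by move=> [x [y [xy ->]]]; exists x, y.
by move=> [x [y [xy ->]]]; exists x, y.
Qed.

(** The vertex set is ['I_m * 'I_k], flattened by [mxvec_index], and the first
    coordinate is the part. Choosing a bijection from [H] to the parts and a
    position in the part for each vertex gives [m! * k ^ m] rainbow embeddings. *)
Lemma max_rainbow_blowup (H : sgraph) (k : nat) : 1 < #|H| ->
  (#|H|)`! * k ^ #|H| <= max_rainbow 'C(#|H|, 2) H (#|H| * k).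
Proof.
set m := #|H| => m1.
have [q q_on _] := curry_mxvec_bij m k.
have qK : cancel (uncurry (@mxvec_index m k)) q by move=> x; exact: q_on.
pose color (e : edge (complete m)) : 'I_'C(m, 2) :=
  cast_ord (card_edge_complete m) (enum_rank e).
have color_inj : injective color by move=> e e' /cast_ord_inj/enum_rank_inj.
have r0 : 0 < 'C(m, 2) by rewrite bin_gt0.
pose part (i : 'I_(m * k)) : 'I_m := (q i).1.
(* An edge inside a part gets a default color; no transversal copy contains one. *)
pose col : edge_coloring 'C(m, 2) (complete (m * k)) :=
  [ffun b : edge (complete (m * k)) =>
     if insub (part @: edge_set b : {set complete m}) is Some e then color e
             else Ordinal r0].
apply: leq_trans (leq_bigmax col).
pose place (p : {ffun H -> 'I_m} * {ffun H -> 'I_k}) (x : H) :=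
  mxvec_index (p.1 x) (p.2 x).
have part_place p x : part (place p x) = p.1 x.
  by rewrite /part /place -[mxvec_index _ _]/(uncurry _ (_, _)) qK.
have place_inj p p' : (forall x, place p x = place p' x) -> p = p'.
  case: p p' => [s g] [s' g'] E.
  have {}E x : (s x, g x) = (s' x, g' x) by apply: (can_inj qK); apply: E.
  by congr (_, _); apply/ffunP => x; case: (E x).
pose A := finset.setX [set s : {ffun H -> 'I_m} | injectiveb s]
                      [set: {ffun H -> 'I_k}].
have -> : m`! * k ^ m = #|A|.
  by rewrite cardsX card_inj_ffuns cardsT card_ffun !card_ord ffactnn.
have A_inj p : p \in A -> injective (place p).
  rewrite !inE andbT => /injectiveP s_inj x y /(congr1 part).
  by rewrite !part_place => /s_inj.
rewrite -(card_in_imset (f := fun p => [ffun x => place p x])); last first.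
  move=> p p' _ _ /ffunP E; apply: place_inj => x.
  by have := E x; rewrite !ffunE.
rewrite -[leqRHS](card_imset _ (val_inj (sT := emb H (complete (m * k))))).
apply/subset_leq_card/fintype.subsetP => _ /imsetP[p pA ->].
apply/imsetP; exists (inj_emb (A_inj p pA)) => //.
have s_inj : injective p.1.
  by move: pA; rewrite !inE andbT => /injectiveP.
rewrite inE; apply/injectiveP.
suff colE a : col (map_edge (inj_emb (A_inj p pA)) a)
              = color (map_edge (inj_emb s_inj) a).
  by move=> a b; rewrite !colE => /color_inj/map_edge_inj.
have E : part @: (inj_emb (A_inj p pA) @: edge_set a)
    = edge_set (map_edge (inj_emb s_inj) a).
  by rewrite -imset_comp; apply: eq_imset => x /=; rewrite !ffunE part_place.
by rewrite ffunE [edge_set _]/= E /edge_set valK.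
Qed.

Local Open Scope ring_scope.

(** * The lower bound on the limit density *)

Lemma rbC_seqE (R : realType) (r : nat) (H : sgraph) (n : nat) :
  rbC_seq R r H n = (max_rainbow r H n)%:R / (n ^_ #|H|)%:R.
Proof.
rewrite /rbC_seq max_rainbow_rb -bin_ffact !natrM !invfM invrK.
by ring.
Qed.

(** Since [(n.+1) ^_ m * (n.+1 - m) = n.+1 * n ^_ m], this is the averaging bound
    divided by the number of all embeddings. *)
Lemma rbC_seq_nincr (R : realType) (r : nat) (H : sgraph) (n p : nat) :
  (#|H| <= n)%N -> (n <= p)%N -> rbC_seq R r H p <= rbC_seq R r H n.
Proof.
move=> Hn; elim: p => [|p IH]; first by rewrite leqn0 => /eqP->.
rewrite leq_eqVlt => /orP[/eqP-> //|]; rewrite ltnS => np.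
apply: le_trans (IH np); rewrite !rbC_seqE.
have Hp := leq_trans Hn np.
rewrite ler_pdivrMr ?ltr0n ?ffact_gt0 ?leqW// mulrAC.
rewrite ler_pdivlMr ?ltr0n ?ffact_gt0// -!natrM ler_nat.
have k0 : (0 < p.+1 - #|H|)%N by rewrite subn_gt0.
rewrite -(leq_pmul2r k0) -[leqRHS]mulnA -ffactnSr ffactSS.
rewrite mulnAC [X in (X * _ <= _)%N]mulnC mulnCA mulnA.
by rewrite leq_mul2r max_rainbow_averaging orbT.
Qed.

(** By monotonicity the value at [n] is at least the value at the multiple [m * n]
    of [m], where the balanced blow-up applies. *)
Lemma rbC_seq_ge (R : realType) (H : sgraph) (n : nat) :
  (1 < #|H|)%N -> (#|H| <= n)%N ->
  (#|H|)`!%:R / #|H|%:R ^+ #|H| <= rbC_seq R 'C(#|H|, 2) H n.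
Proof.
move=> H1 Hn; have H0 := ltnW H1; have n0 := leq_trans H0 Hn.
apply: le_trans (rbC_seq_nincr R 'C(#|H|, 2) Hn (leq_pmull n H0)).
rewrite rbC_seqE; set m := #|H| in H0 H1 Hn *.
have mR : 0 < m%:R :> R by rewrite ltr0n.
have nR : 0 < n%:R :> R by rewrite ltr0n.
rewrite ler_pdivlMr; last by rewrite ltr0n ffact_gt0 leq_pmulr.
apply: (@le_trans _ _ (m`! * n ^ m)%:R); last first.
  by rewrite ler_nat max_rainbow_blowup.
have -> : (m`! * n ^ m)%:R = m`!%:R / m%:R ^+ m * ((m * n) ^ m)%:R :> R.
  rewrite !natrM !natrX natrM exprMn; field.
  by rewrite expf_neq0// gt_eqF.
rewrite ler_wpM2l ?divr_ge0 ?exprn_ge0// ler_nat.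
rewrite ffact_prod -[X in (_ <= _ ^ X)%N]card_ord -prod_nat_const.
by apply: leq_prod => i _; apply: leq_subr.
Qed.

Lemma rbC_ge (R : realType) (H : sgraph) : (1 < #|H|)%N ->
  (#|H|)`!%:R / #|H|%:R ^+ #|H| <= rbC R 'C(#|H|, 2) H.
Proof.
move=> H1; apply: limr_ge.
  apply: (@near_nonincreasing_is_cvgn _ _ 0); last first.
    near=> n; apply: le_trans (rbC_seq_ge R H1 (_ : #|H| <= n)%N).
      by rewrite divr_ge0// exprn_ge0.
    by near: n; exact: nbhs_infty_ge.
  near=> n => p np; apply: rbC_seq_nincr np.
  by near: n; exact: nbhs_infty_ge.
by near=> n; apply: rbC_seq_ge H1 _; near: n; exact: nbhs_infty_ge.
Unshelve. all: by end_near.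
Qed.

(** * The trapezoidal rule for the logarithm *)

(** Both sides agree at [1], and the derivative of the difference is
    [ln w + 1 / w - 1], which is nonnegative by [ln (1 / w) <= 1 / w - 1]. *)
Lemma ln_ge_frac (R : realType) (w : R) :
  1 <= w -> 2 * (w - 1) <= (w + 1) * ln w.
Proof.
move=> w1.
pose g := fun x : R => (x + 1) * ln x - 2 * (x - 1).
have dg (x : R) : 0 < x -> is_derive x 1 g (ln x + x^-1 - 1).
  move=> x0; have := is_derive1_ln x0 => dl.
  rewrite /g; apply: is_derive_eq.
  rewrite /GRing.scale /=; field; lra.
have : g 1 <= g w.
  apply: (@ger0_derive1_ndecry _ g 1) => //.
  - move=> x; rewrite in_itv /= andbT => x1.
    by apply: ex_derive; apply: dg; lra.
  - move=> x; rewrite in_itv /= andbT => x1.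
    have x0 : 0 < x by lra.
    have := dg x x0 => dgx; rewrite derive1E derive_val.
    have xV0 : 0 < x^-1 by rewrite invr_gt0.
    have : ln (1 + (x^-1 - 1)) <= x^-1 - 1 by apply: le_ln1Dx; lra.
    rewrite addrC subrK lnV ?posrE//; lra.
  - apply: continuous_in_subspaceT => x; rewrite inE /= in_itv /= andbT => x1.
    have := dg x (lt_le_trans ltr01 x1) => dgx.
    by apply/differentiable_continuous/derivable1_diffP/ex_derive.
rewrite /g ln1; lra.
Qed.

(** The right-hand side is the integral of [ln] from [v] to [u], the left-hand side
    its trapezoidal approximation, too small because [ln] is concave. Dividing by
    [v] turns the inequality into [ln_ge_frac] at [w = u / v]. *)
Lemma ln_trapezoid (R : realType) (u v : R) : 0 < v -> v <= u ->
  (u - v) * (ln u + ln v) / 2 <= (u * ln u - u) - (v * ln v - v).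
Proof.
move=> v0 vu; have u0 := lt_le_trans v0 vu.
have := @ln_ge_frac R (u / v).
rewrite ler_pdivlMr// mul1r => /(_ vu).
rewrite ln_div ?posrE// -(ler_pM2r v0).
have -> : 2 * (u / v - 1) * v = 2 * (u - v) by field; lra.
have -> : (u / v + 1) * (ln u - ln v) * v = (u + v) * (ln u - ln v).
  by field; lra.
nra.
Qed.

(** * Estimates for falling factorials and factorials *)

Lemma ffact_ratioS (R : realType) (N k : nat) : (k <= N)%N -> (0 < N)%N ->
  (N ^_ k.+1)%:R / N%:R ^+ k.+1
  = (N ^_ k)%:R / N%:R ^+ k * (1 - k%:R / N%:R) :> R.
Proof.
move=> kN N0; have N0R : N%:R != 0 :> R by rewrite pnatr_eq0 -lt0n.
rewrite ffactnSr natrM natrB// exprS.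
by field; rewrite expf_neq0// N0R.
Qed.

Lemma ffact_ratio_le (R : realType) (N k e : nat) : (k <= e)%N -> (0 < N)%N ->
  (N ^_ e)%:R / N%:R ^+ e <= (N ^_ k)%:R / N%:R ^+ k :> R.
Proof.
move=> ke N0; have N0R : 0 < N%:R :> R by rewrite ltr0n.
elim: e ke => [|e IH]; first by rewrite leqn0 => /eqP->.
rewrite leq_eqVlt => /orP[/eqP-> //|]; rewrite ltnS => /IH; apply: le_trans.
have P0 : 0 <= (N ^_ e)%:R / N%:R ^+ e :> R by rewrite divr_ge0// exprn_ge0.
have [Ne|eN] := ltnP N e; first by rewrite ffact_small ?mul0r// ltnW.
rewrite ffact_ratioS// ler_piMr// gerBl divr_ge0//.
Qed.

(** The bound of [ffact_ratio_le_expR] at [c = k / N]. By induction on [k]: the step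
    is the trapezoidal rule on one interval of length [1 / N], and the half terms
    at both ends telescope into [- ln u / 2]. *)
Lemma ffact_ratio_le_expR_grid (R : realType) (N k : nat) : (k < N)%N ->
  let u := 1 - k%:R / N%:R : R in
  (N ^_ k)%:R / N%:R ^+ k
    <= expR (- (N%:R * (1 + (u * ln u - u))) - ln u / 2) :> R.
Proof.
move=> kN /=; have N0 : 0 < N%:R :> R by rewrite ltr0n (leq_ltn_trans _ kN).
elim: k kN => [|k IH] kN.
  rewrite mul0r subr0 ln1 ffactn0 expr0 divr1 !mul0r mulr0.
  by rewrite subr0 sub0r subrr mulr0 oppr0 expR0.
have uE : 1 - k.+1%:R / N%:R = 1 - k%:R / N%:R - N%:R^-1 :> R.
  by rewrite -natr1; field; lra.
have v0 : 0 < 1 - k.+1%:R / N%:R :> R.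
  by rewrite subr_gt0 ltr_pdivrMr// mul1r ltr_nat.
have NV : 0 < N%:R^-1 :> R by rewrite invr_gt0.
have u0 : 0 < 1 - k%:R / N%:R :> R by rewrite uE in v0; lra.
rewrite ffact_ratioS// ?(ltnW (ltnW kN))// ?(leq_ltn_trans _ kN)//.
have := ler_wpM2r (ltW u0) (IH (ltnW kN)).
move/le_trans; apply.
rewrite -[X in _ * X <= _]lnK ?posrE// -expRD ler_expR.
have vu : 1 - k.+1%:R / N%:R <= 1 - k%:R / N%:R :> R by rewrite uE; lra.
have := @ln_trapezoid R _ _ v0 vu.
move: uE v0 u0 vu.
set u := 1 - k%:R / _; set v := 1 - _.
move=> uE v0 u0 vu.
have -> : u - v = N%:R^-1 by rewrite uE; ring.
move=> T.
have := ler_wpM2l (ltW N0) T.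
have -> : N%:R * (N%:R^-1 * (ln u + ln v) / 2) = (ln u + ln v) / 2.
  by field; lra.
nra.
Qed.

(** For [c * N] strictly between two integers [k] and [k.+1], the product already
    contains the whole factor at [k], since [e] is an integer; the trapezoidal
    rule on the partial interval from [k / N] to [c], of relative length at most
    [1], therefore suffices. *)
Lemma ffact_ratio_le_expR (R : realType) (N e : nat) (c : R) :
  (0 < N)%N -> 0 <= c -> c < 1 -> c * N%:R <= e%:R ->
  (N ^_ e)%:R / N%:R ^+ e
    <= expR (- (N%:R * (c + (1 - c) * ln (1 - c))) - ln (1 - c) / 2).
Proof.
move=> N0 c0 c1 ce; have N0R : 0 < N%:R :> R by rewrite ltr0n.
have cN0 : 0 <= c * N%:R by rewrite mulr_ge0.
have /andP[kc ck] := truncn_itv cN0.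
set k := Num.truncn _ in kc ck.
have kN : (k < N)%N.
  by rewrite -(ltr_nat R) (le_lt_trans kc)// gtr_pMl.
have grid := @ffact_ratio_le_expR_grid R _ _ kN.
have cE : c + (1 - c) * ln (1 - c) = 1 + ((1 - c) * ln (1 - c) - (1 - c)).
  by ring.
rewrite cE {cE}.
have : (k <= e)%N by rewrite -(ler_nat R) (le_trans kc ce).
rewrite leq_eqVlt => /orP[/eqP ke|ke].
  have cE : c = k%:R / N%:R.
    by apply: (mulIf (lt0r_neq0 N0R)); rewrite divfK ?gt_eqF//;
       apply/eqP; rewrite eq_le kc ke ce.
  by rewrite -ke cE.
apply: le_trans (@ffact_ratio_le R _ _ _ ke N0) _.
have v0 : 0 < 1 - c by lra.
have vu : 1 - c <= 1 - k%:R / N%:R.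
  by rewrite lerD2l lerN2 ler_pdivrMr.
have u0 := lt_le_trans v0 vu.
have lnu : ln (1 - k%:R / N%:R) <= 0 :> R.
  by apply: ln_le0; rewrite gerBl divr_ge0.
have lnv : ln (1 - c) <= 0 by apply: ln_le0; rewrite gerBl.
rewrite ffact_ratioS// ?(ltnW kN)//.
apply: le_trans (ler_wpM2r (ltW u0) grid) _.
rewrite -[X in _ * X <= _]lnK ?posrE// -expRD ler_expR.
have T := @ln_trapezoid R _ _ v0 vu.
have := ler_wpM2l (ltW N0R) T.
have : N%:R * (1 - k%:R / N%:R - (1 - c)) <= 1.
  have -> : N%:R * (1 - k%:R / N%:R - (1 - c)) = c * N%:R - k%:R.
    by field; lra.
  by rewrite -natr1 in ck; lra.
move: lnu lnv; set u := 1 - k%:R / _; set v := 1 - c => lnu lnv s1.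
set G := u * _ - u; set F := v * _ - v.
have -> : N%:R * ((u - v) * (ln u + ln v) / 2)
   = (N%:R * (u - v)) * (ln u + ln v) / 2 by ring.
(* Both logarithms are nonpositive, so shrinking the width of the trapezoid
   from [1] to [s] only increases its signed area. *)
set s := N%:R * (u - v) in s1 *.
nra.
Qed.

(** Induction from [m = 4] with [(1 + 1 / m) ^ m <= exp 1]. The base case
    [1024 < 24 * exp 4] needs [exp 1 > 2.556], for which [exp (1 / 8) >= 9 / 8]
    is sharp enough. *)
Lemma fact_ratio_gt (R : realType) (m : nat) : (3 < m)%N ->
  4 * expR (- m%:R) < m`!%:R / m%:R ^+ m :> R.
Proof.
move=> m3; have m0 : 0 < m%:R :> R by rewrite ltr0n (leq_ltn_trans _ m3).
rewrite expRN ltr_pdivlMr ?exprn_gt0// mulrAC ltr_pdivrMr ?expR_gt0//.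
have {m0} : (3 < m)%N by [].
elim: m {m3} => // m IH; rewrite ltnS leq_eqVlt => /orP[/eqP<-|m3].
  have e8 : 9 / 8 <= expR (1 / 8) :> R.
    by apply: le_trans (expR_ge1Dx _); lra.
  have e2 : 8 / 5 <= expR (1 / 8) ^+ 4 :> R.
    by apply: le_trans (lerXn2r 4 _ _ e8); rewrite ?nnegrE ?expR_ge0//; lra.
  have : (8 / 5) ^+ 8 <= (expR (1 / 8) ^+ 4) ^+ 8 :> R.
    by rewrite lerXn2r ?nnegrE ?exprn_ge0 ?expR_ge0//; lra.
  rewrite -exprM -expRM_natl.
  have -> : (4 * 8)%:R * (1 / 8) = 4 :> R by rewrite natrM; field.
  by rewrite !factS fact0; lra.
have IHm := IH m3; have m0 : 0 < m%:R :> R by rewrite ltr0n (leq_trans _ m3).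
rewrite factS natrM exprS -[m.+1%:R]natr1 expRD.
move: IHm; have : (m%:R + 1) ^+ m <= m%:R ^+ m * expR 1 :> R.
  have -> : m%:R + 1 = m%:R * (1 + m%:R^-1) :> R by field; lra.
  rewrite exprMn ler_pM2l ?exprn_gt0//.
  have -> : 1 = m%:R * m%:R^-1 :> R by rewrite divff ?gt_eqF.
  rewrite expRM_natl lerXn2r ?nnegrE ?expR_ge0 ?addr_ge0 ?invr_ge0//.
  by rewrite divff ?gt_eqF// expR_ge1Dx.
set E := expR 1; set A := _ ^+ m; set B := _ ^+ m; set F := _`!%:R.
set X := expR _ => h1 h2.
have E0 : 0 < E by exact: expR_gt0.
have : (m%:R + 1) * E * (4 * B) < (m%:R + 1) * E * (F * X).
  by rewrite ltr_pM2l// mulr_gt0//; lra.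
have : 4 * (m%:R + 1) * A <= 4 * (m%:R + 1) * (B * E).
  by rewrite ler_pM2l//; lra.
lra.
Qed.

(** For large [c] the factor [1 / sqrt (1 - c)] is too big, but the exponent then
    has room to spare, so the estimate is applied at [d = min (c, 15 / 16)], where
    [1 / sqrt (1 - d) <= 4]. *)
Lemma ffact_ratio_lt_fact_ratio (R : realType) (m e : nat) (c : R) : (1 < m)%N ->
  0 <= c < 1 -> 2 / (m%:R - 1) < c + (1 - c) * ln (1 - c) ->
  c * 'C(m, 2)%:R <= e%:R ->
  ('C(m, 2) ^_ e)%:R / 'C(m, 2)%:R ^+ e < m`!%:R / m%:R ^+ m :> R.
Proof.
move=> m1 /andP[c0 c1] hc ce.
have m1R : 0 < m%:R - 1 :> R by rewrite subr_gt0 ltr1n.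
have m3R : 3 < m%:R :> R.
  have : 2 / (m%:R - 1) < 1 :> R.
    apply: (lt_trans hc).
    have : ln (1 - c) <= 0 by apply: ln_le0; lra.
    nra.
  by rewrite ltr_pdivrMr//; lra.
have m3 : (3 < m)%N by rewrite -(ltr_nat R).
have C2 : 'C(m, 2)%:R = m%:R * (m%:R - 1) / 2 :> R.
  have := mul_bin_diag m 1; rewrite bin1.
  move/(congr1 (fun n => n%:R : R)); rewrite !natrM -subn1 natrB ?(ltnW m1)//; lra.
have N0 : (0 < 'C(m, 2))%N by rewrite bin_gt0.
have [d [d0 d1 dc hd]] : exists d : R, [/\ 0 <= d, d <= 15 / 16, d <= c &
    2 / (m%:R - 1) <= d + (1 - d) * ln (1 - d)].
  have [c16|c16] := leP c (15 / 16).
    by exists c; split => //; exact: ltW.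
  exists (15 / 16); split; [lra|lra|exact: ltW|].
  have -> : 1 - 15 / 16 = (2 ^+ 4)^-1 :> R by field.
  rewrite lnV ?posrE ?exprn_gt0// lnXn//.
  have : ln (1 + 1) <= 1 :> R by apply: le_ln1Dx; lra.
  rewrite -[1 + 1]/2 => l2.
  have : 2 / (m%:R - 1) <= 2 / 3 :> R.
    rewrite ler_pdivrMr//; have : 4 <= m%:R :> R by rewrite ler_nat.
    lra.
  have -> : (2 ^+ 4)^-1 = 1 / 16 :> R by field.
  rewrite -[ln 2 *+ 4]mulr_natr; lra.
apply: le_lt_trans (fact_ratio_gt R m3).
apply: le_trans (@ffact_ratio_le_expR R _ e d N0 d0 _ _) _; first by lra.
  by apply: le_trans ce; rewrite ler_wpM2r.
have d0' : 0 < 1 - d by lra.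
rewrite expRD mulrC ler_pM ?expR_ge0//; last first.
  rewrite ler_expR lerN2 C2.
  have mE : m%:R = m%:R * (m%:R - 1) / 2 * (2 / (m%:R - 1)) :> R by field; lra.
  rewrite [leLHS]mE ler_pM2l//; by rewrite divr_gt0// mulr_gt0//; lra.
rewrite expRN -[leRHS]invrK lef_pV2 ?posrE ?expR_gt0 ?invr_gt0//.
rewrite -(@ler_pXn2r _ 2) ?nnegrE ?expR_ge0//.
rewrite -expRM_natl mulrC divfK ?pnatr_eq0// lnK ?posrE//.
lra.
Qed.

(** * Comparison with the random coloring *)

Theorem theorem4p5 (R : realType) (H : sgraph) (m e : nat) (c : R)
  (hm : #|H| = m) (he : #|edges H| = e)
  (m_gt1 : (1 < m)%N) (c_ge0 : 0 <= c)
  (hpi : 1 < 2 * pi * m%:R * (1 - c))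
  (hc : 2 / (m%:R - 1) + 1 / (12 * 'C(m, 2)%:R ^+ 2)
        <= c + (1 - c) * ln (1 - c))
  (hec : c * 'C(m, 2)%:R <= e%:R) :
  ~ anti_common R 'C(m, 2) H.
Proof.
have c_lt1 : c < 1.
  rewrite -subr_gt0 -(@pmulr_rgt0 _ (2 * pi * m%:R)); first exact: lt_trans hpi.
  by rewrite !mulr_gt0 ?pi_gt0// ltr0n ltnW.
have {}hc : 2 / (m%:R - 1) < c + (1 - c) * ln (1 - c).
  apply: lt_le_trans hc; rewrite ltrDl divr_gt0// mulr_gt0// exprn_gt0//.
  by rewrite ltr0n bin_gt0.
have c01 : 0 <= c < 1 by rewrite c_ge0.
have lt := ffact_ratio_lt_fact_ratio m_gt1 c01 hc hec.
have le := @rbC_ge R H; rewrite hm in le.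
rewrite /anti_common he => E; have := lt_le_trans lt (le m_gt1).
by rewrite E -natrM bin_ffact ltxx.
Qed.
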